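(* Let $\mathcal{C}$ be an equational class of algebras and $A$ an algebra from $\mathcal{C}$. Assume that $\mathcal{C}$ is congruence-distributive, or that $\mathcal{C}$ is congruence-modular and the commutator in $A$ equals the intersection (that is, $[\alpha,\beta]_A=\alpha\cap\beta$ for all $\alpha,\beta\in \mathrm{Con}(A)$). Let $\phi\in \mathrm{Con}(A)$. Then: (1) if $\phi$ is strictly meet-irreducible in $\mathrm{Con}(A)$, then $\phi\in \mathrm{Spec}(A)$; (2) if $\phi\in \mathrm{Spec}(A)$, then $\phi$ is proper and meet-irreducible in $\mathrm{Con}(A)$; (3) if the principal filter $[\phi)=\{\gamma\in \mathrm{Con}(A) : \phi\subseteq\gamma\}$ is finite, then: $\phi\in \mathrm{Spec}(A)$ iff $\phi$ is strictly meet-irreducible iff $\phi$ is proper and meet-irreducible; (4) if $\mathrm{Con}(A)$ is finite, then: $\phi\in \mathrm{Spec}(A)$ iff $\phi$ is strictly meet-irreducible iff $\phi$ is proper and meet-irreducible.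
   Context: All algebras are non-empty. $\mathrm{Con}(M)$ is the lattice of congruences of an algebra $M$ ordered by inclusion, with greatest element $\nabla_M=M^2$; a congruence is proper if it differs from $\nabla_M$. An equational class (variety) is congruence-modular (congruence-distributive) if $\mathrm{Con}(M)$ is modular (distributive) for each member $M$. In a congruence-modular equational class, $[\alpha,\beta]_M$ denotes the (Freese–McKenzie) commutator of $\alpha,\beta\in \mathrm{Con}(M)$: the least $\delta\in \mathrm{Con}(M)$ such that for all $m,n$, every $(m+n)$-ary term $t$, all $(a_i,b_i)\in\alpha$ ($1\le i\le m$) and all $(c_j,d_j)\in\beta$ ($1\le j\le n$), $(t(\bar a,\bar c),t(\bar a,\bar d))\in\delta$ implies $(t(\bar b,\bar c),t(\bar b,\bar d))\in\delta$. In a congruence-distributive equational class the commutator coincides with the intersection of congruences. A proper congruence $\phi$ of $A$ is prime if, for all $\alpha,\beta\in \mathrm{Con}(A)$, $[\alpha,\beta]_A\subseteq\phi$ implies $\alpha\subseteq\phi$ or $\beta\subseteq\phi$; $\mathrm{Spec}(A)$ is the set of prime congruences of $A$. An element $x$ of a lattice $L$ is meet-irreducible if $x=a\wedge b$ implies $x=a$ or $x=b$; it is strictly meet-irreducible if $\min\{y\in L : x<y\}$ exists. *)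

(* Defs.v *)
From HB Require Import structures.
From mathcomp Require Import all_boot all_order.
From mathcomp Require Import boolp classical_sets cardinality.

Set Implicit Arguments.
Unset Strict Implicit.
Unset Printing Implicit Defensive.

Import Order.TTheory.
Local Open Scope classical_set_scope.
Local Open Scope order_scope.

Record signature := Signature {
  symbol : Type;
  arity : symbol -> nat
}.

Record algebra (Sg : signature) := Algebra {
  carrier :> Type;
  oper : forall o : symbol Sg, ('I_(arity o) -> carrier) -> carrier;
  algebra_nonempty : inhabited carrier
}.

Inductive term (Sg : signature) (X : Type) : Type :=
| Var of X
| App (o : symbol Sg) of ('I_(arity o) -> term Sg X).

Fixpoint eval (Sg : signature) (M : algebra Sg) (X : Type) (v : X -> M)
    (t : term Sg X) : M :=
  match t with
  | Var x => v x
  | App o ts => oper (fun i => eval v (ts i))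
  end.

Definition satisfies (Sg : signature) (M : algebra Sg)
    (e : term Sg nat * term Sg nat) : Prop :=
  forall v : nat -> M, eval v e.1 = eval v e.2.

(* [algebra Sg -> Prop] and not [set (algebra Sg)]: the latter would force the
   universe of carriers below that of ['I_n], and with it that of [term Sg X],
   so that free algebras would no longer be algebras. *)
Definition equational_class (Sg : signature) (C : algebra Sg -> Prop) : Prop :=
  exists E : set (term Sg nat * term Sg nat),
    forall M : algebra Sg, C M <-> (forall e, E e -> satisfies M e).

Record is_congruence (Sg : signature) (M : algebra Sg)
    (r : M -> M -> Prop) : Prop := IsCongruence {
  congr_refl : forall x, r x x;
  congr_sym : forall x y, r x y -> r y x;
  congr_trans : forall x y z, r x y -> r y z -> r x z;
  congr_oper : forall (o : symbol Sg) (a b : 'I_(arity o) -> M),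
    (forall i, r (a i) (b i)) -> r (oper a) (oper b)
}.

Record Con (Sg : signature) (M : algebra Sg) := MkCon {
  con_rel :> M -> M -> Prop;
  conP : is_congruence con_rel
}.

HB.instance Definition _ (Sg : signature) (M : algebra Sg) :=
  gen_eqMixin (Con M).
HB.instance Definition _ (Sg : signature) (M : algebra Sg) :=
  gen_choiceMixin (Con M).

Fact con_display : Order.disp_t. Proof. exact: Order.Disp tt tt. Qed.

Section ConLattice.
Variables (Sg : signature) (M : algebra Sg).
Implicit Types (alpha beta gamma delta : Con M) (S : set (Con M)).

Lemma con_ext alpha beta :
  (forall x y, alpha x y <-> beta x y) -> alpha = beta.
Proof.
case: alpha => r rP; case: beta => s sP /= rs.
have e : r = s by apply/funext => x; apply/funext => y; apply/propext/rs.
by case: _ / e sP => sP; congr MkCon; apply: Prop_irrelevance.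
Qed.

Definition con_le alpha beta : bool :=
  `[< forall x y, alpha x y -> beta x y >].

Fact con_le_refl : reflexive con_le.
Proof. by move=> a; apply/asboolP. Qed.

Fact con_le_anti : antisymmetric con_le.
Proof.
move=> a b /andP[/asboolP ab /asboolP ba].
by apply: con_ext => x y; split; [apply: ab | apply: ba].
Qed.

Fact con_le_trans : transitive con_le.
Proof.
move=> b a c /asboolP ab /asboolP bc; apply/asboolP => x y axy.
exact/bc/ab.
Qed.

HB.instance Definition _ := Order.Le_isPOrder.Build con_display
  (Con M) con_le_refl con_le_anti con_le_trans.

Lemma con_leP alpha beta :
  reflect (forall x y, alpha x y -> beta x y) (alpha <= beta).
Proof. exact: asboolP. Qed.

Fact con_bigcap_subproof S :
  is_congruence (fun x y : M => forall gamma, S gamma -> gamma x y).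
Proof.
split.
- by move=> x g _; apply: (congr_refl (conP g)).
- by move=> x y xy g /xy; apply: (congr_sym (conP g)).
- move=> x y z xy yz g Sg'.
  exact: (congr_trans (conP g) (xy _ Sg') (yz _ Sg')).
- by move=> o a b ab g Sg'; apply: (congr_oper (conP g)) => i; apply: ab.
Qed.

Definition con_bigcap S : Con M := MkCon (con_bigcap_subproof S).

Definition con_meet alpha beta : Con M := con_bigcap [set alpha; beta].

Definition con_join alpha beta : Con M :=
  con_bigcap [set gamma | alpha <= gamma /\ beta <= gamma].

Fact con_meetP alpha beta gamma :
  (alpha <= con_meet beta gamma) = (alpha <= beta) && (alpha <= gamma).
Proof.
apply/con_leP/andP => [h|[/con_leP ab /con_leP ac] x y axy d [->|->]].
- by split; apply/con_leP => x y /h; apply; [left | right].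
- exact: ab.
- exact: ac.
Qed.

Fact con_joinP alpha beta gamma :
  (con_join alpha beta <= gamma) = (alpha <= gamma) && (beta <= gamma).
Proof.
apply/con_leP/andP => [h|[ac bc] x y]; last by apply.
by split; apply/con_leP => x y xy; apply: h => d [/con_leP ad /con_leP bd];
  [apply: ad | apply: bd].
Qed.

HB.instance Definition _ :=
  Order.POrder_MeetJoin_isLattice.Build con_display (Con M)
    con_meetP con_joinP.

Fact nabla_subproof : is_congruence (fun _ _ : M => True).
Proof. by []. Qed.

Definition nabla : Con M := MkCon nabla_subproof.

Fact con_le_nabla alpha : alpha <= nabla.
Proof. exact/con_leP. Qed.

HB.instance Definition _ :=
  Order.hasTop.Build con_display (Con M) con_le_nabla.

Lemma con_meetE alpha beta x y :
  (alpha `&` beta) x y <-> alpha x y /\ beta x y.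
Proof.
rewrite -[alpha `&` beta]/(con_meet alpha beta).
split=> [h|[axy bxy] g [->|->] //].
by split; apply: h; [left | right].
Qed.

End ConLattice.

Definition congruence_modular (Sg : signature) (C : algebra Sg -> Prop) : Prop :=
  forall M, C M -> forall alpha beta gamma : Con M, alpha <= gamma ->
    alpha `|` (beta `&` gamma) = (alpha `|` beta) `&` gamma.

Definition congruence_distributive (Sg : signature) (C : algebra Sg -> Prop) :
    Prop :=
  forall M, C M -> forall alpha beta gamma : Con M,
    alpha `&` (beta `|` gamma) = (alpha `&` beta) `|` (alpha `&` gamma).

Section Commutator.
Variables (Sg : signature) (M : algebra Sg).
Implicit Types alpha beta delta phi : Con M.

Definition env2 (m n : nat) (a : 'I_m -> M) (c : 'I_n -> M)
    (i : 'I_(m + n)) : M :=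
  match split i with inl j => a j | inr k => c k end.

Definition term_condition alpha beta delta : Prop :=
  forall (m n : nat) (t : term Sg 'I_(m + n))
         (a b : 'I_m -> M) (c d : 'I_n -> M),
    (forall i, alpha (a i) (b i)) -> (forall j, beta (c j) (d j)) ->
    delta (eval (env2 a c) t) (eval (env2 a d) t) ->
    delta (eval (env2 b c) t) (eval (env2 b d) t).

(* This is the least congruence satisfying the term condition, by
   [commutator_term_condition] and [commutator_least] below. *)
Definition commutator alpha beta : Con M :=
  con_bigcap [set delta | term_condition alpha beta delta].

Lemma commutator_term_condition alpha beta :
  term_condition alpha beta (commutator alpha beta).
Proof.
by move=> m n t a b c d ab cd h g tg; apply: (tg m n t a b) => //; apply: h.
Qed.

Lemma commutator_least alpha beta delta :
  term_condition alpha beta delta -> commutator alpha beta <= delta.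
Proof. by move=> h; apply/con_leP => x y; apply. Qed.

Definition prime_congruence phi : Prop :=
  phi <> \top /\
  forall alpha beta : Con M,
    commutator alpha beta <= phi -> alpha <= phi \/ beta <= phi.

End Commutator.

Definition Spec (Sg : signature) (A : algebra Sg) : set (Con A) :=
  [set phi | prime_congruence phi].

Arguments Spec {Sg} A.

Definition meet_irreducible (disp : Order.disp_t) (L : latticeType disp)
    (x : L) : Prop :=
  forall a b : L, x = a `&` b -> x = a \/ x = b.

Definition strictly_meet_irreducible (disp : Order.disp_t)
    (L : latticeType disp) (x : L) : Prop :=
  exists m : L, x < m /\ forall y : L, x < y -> m <= y.

(* Main.v *)
Require Import Defs.
From mathcomp Require Import all_boot all_order.
From mathcomp Require Import boolp classical_sets cardinality.

(** The heart of the matter is that [Con A] is modular, that the commutator is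
    the meet, and that [alpha `&` beta <= phi] forces
    [(phi `|` alpha) `&` (phi `|` beta) = phi].

    In the distributive case, view [beta] as a subalgebra of [A * A], let
    [eta1], [eta2] be the kernels of its projections and let [Delta] be the
    congruence of [beta] generated by the pairs [((a, a), (b, b))] with
    [alpha a b].  If [a] and [b] are related by both [alpha] and [beta], then
    [(a, a)] and [(a, b)] are related by [eta1] and by [Delta `|` eta2], hence
    by distributivity by [Delta].  As [Delta] preserves membership in any
    [delta] satisfying the term condition, [delta a b] holds.

    If [alpha `&` beta <= phi], then modularity allows one to replace [alpha],
    [beta] by [x], [y] such that [phi], [x], [y] have the same pairwise meets
    [p] and [phi `|` x = phi `|` y = (phi `|` alpha) `&` (phi `|` beta)].
    The term condition holds for [(phi, y; p)] and for [(x, y; p)], so for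
    [(phi `|` x, y; p)], whence [y = (phi `|` x) `&` y <= p <= phi]. *)

Set Implicit Arguments.
Unset Strict Implicit.
Unset Printing Implicit Defensive.

Import Order.TTheory.
Local Open Scope classical_set_scope.
Local Open Scope order_scope.

(** * Renaming and evaluation of terms *)

Section Terms.
Variable Sg : signature.

Fixpoint rename (X Y : Type) (f : X -> Y) (t : term Sg X) : term Sg Y :=
  match t with
  | Var x => Var Sg (f x)
  | App o ts => App (fun i => rename f (ts i))
  end.

Fixpoint vars (X : Type) (t : term Sg X) : seq X :=
  match t with
  | Var x => [:: x]
  | App o ts => flatten [seq vars (ts i) | i <- enum 'I_(arity o)]
  end.

Lemma eval_rename (M : algebra Sg) (X Y : Type) (f : X -> Y) (v : Y -> M)
    (t : term Sg X) :
  eval v (rename f t) = eval (v \o f) t.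
Proof.
by elim: t => //= o ts IH; congr oper; apply/funext => i; apply: IH.
Qed.

Lemma eq_in_eval (M : algebra Sg) (X : eqType) (v w : X -> M)
    (t : term Sg X) :
  {in vars t, v =1 w} -> eval v t = eval w t.
Proof.
elim: t => /= [x|o ts IH] vw; first by apply: vw; rewrite inE.
congr oper; apply/funext => i; apply: IH => x xt; apply: vw.
by apply/flatten_mapP; exists i; rewrite ?mem_enum.
Qed.

Lemma eval_hom (M N : algebra Sg) (h : M -> N) (X : Type) (v : X -> M)
    (t : term Sg X) :
  (forall o (a : 'I_(arity o) -> M), h (oper a) = oper (h \o a)) ->
  h (eval v t) = eval (h \o v) t.
Proof.
move=> hM; elim: t => //= o ts IH; rewrite hM; congr oper.
by apply/funext => i /=; apply: IH.
Qed.

Lemma congr_eval (M : algebra Sg) (r : Con M) (X : Type) (v w : X -> M)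
    (t : term Sg X) :
  (forall x, r (v x) (w x)) -> r (eval v t) (eval w t).
Proof. by move=> vw; elim: t => //= o ts IH; apply: (congr_oper (conP r)). Qed.

End Terms.

(** * Chains and transitive closure *)

Section Chains.

(* The chain is constant from index [n] on, so that finitely many chains can be
   run in parallel. *)
Definition chain (T : Type) (r : T -> T -> Prop) (n : nat) (f : nat -> T)
    (x y : T) : Prop :=
  [/\ f 0%N = x, forall j, (n <= j)%N -> f j = y &
      forall j, r (f j) (f j.+1)].

Definition chain_closure (T : Type) (r : T -> T -> Prop) (x y : T) : Prop :=
  exists n f, chain r n f x y.

Lemma chain_closure_family (T : Type) (r : T -> T -> Prop) (k : nat)
    (a b : 'I_k -> T) :
  (forall i, chain_closure r (a i) (b i)) ->
  exists n (f : nat -> 'I_k -> T),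
    [/\ f 0%N = a, forall j, (n <= j)%N -> f j = b &
        forall j i, r (f j i) (f j.+1 i)].
Proof.
move=> /choice[n] /choice[f] fP.
exists (\max_i n i)%N, (fun j i => f i j); split.
- by apply/funext => i; have [] := fP i.
- move=> j nj; apply/funext => i; have [_ fb _] := fP i; apply: fb.
  by apply: leq_trans nj; apply: leq_bigmax.
- by move=> j i; have [] := fP i.
Qed.

Lemma sub_chain_closure (T : Type) (r : T -> T -> Prop) (x y : T) :
  (forall z, r z z) -> r x y -> chain_closure r x y.
Proof.
by move=> rr xy; exists 1%N, (fun j => if j is 0%N then x else y); split;
  [|case|case].
Qed.

(** Transitivity concatenates chains; for compatibility the chains of the arguments run in parallel
    and [oper] is applied at each index. *)
Lemma chain_closure_congruence (Sg : signature) (M : algebra Sg)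
    (r : M -> M -> Prop) :
  (forall x, r x x) -> (forall x y, r x y -> r y x) ->
  (forall (o : symbol Sg) (a b : 'I_(arity o) -> M),
     (forall i, r (a i) (b i)) -> r (oper a) (oper b)) ->
  is_congruence (chain_closure r).
Proof.
move=> rr rs ro; split.
- by move=> x; apply: sub_chain_closure.
- move=> x y [n [f [fx fy fr]]]; exists n, (fun j => f (n - j)%N); split.
  + by rewrite subn0 fy.
  + by move=> j nj; rewrite (eqP (nj : (n - j)%N == 0%N)).
  + move=> j; case: (ltnP j n) => jn; last first.
      have -> : (n - j.+1)%N = 0%N by apply/eqP; rewrite subn_eq0 leqW.
      have -> : (n - j)%N = 0%N by apply/eqP; rewrite subn_eq0.
      exact: rr.
    by rewrite -(@subnSK j n) //; apply: rs.
- move=> x y z [n [f [fx fy fr]]] [m [g [gy gz gr]]].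
  exists (n + m)%N, (fun j => if (j <= n)%N then f j else g (j - n)%N); split.
  + by rewrite leq0n.
  + move=> j nmj; case: (leqP j n) => jn; last first.
      by apply: gz; rewrite leq_subRL // ltnW.
    (* An index from [n + m] on is read from [f] only if [m = 0]; then [g] is constant and
       [y = z]. *)
    have m0 : m = 0%N.
      have := leq_trans nmj jn; rewrite -[X in (_ <= X)%N]addn0 leq_add2l.
      by rewrite leqn0 => /eqP.
    rewrite fy -?gy ?gz ?m0 //.
    by move: nmj; rewrite m0 addn0.
  + move=> j; case: (leqP j.+1 n) => jn; first by rewrite (ltnW jn).
    rewrite subSn //; case: (ltngtP j n) => [jn'|//|->].
    * by move: jn; rewrite ltnNge jn'.
    * by rewrite subnn fy // -gy.
- move=> o a b /chain_closure_family[n [f [fa fb fr]]].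
  exists n, (fun j => oper (f j)); split => [|j /fb ->|j]; rewrite ?fa //.
  exact: ro.
Qed.

End Chains.

(** * The term condition *)

Section TermCondition.
Variables (Sg : signature) (M : algebra Sg).
Implicit Types alpha beta delta phi : Con M.

(** A term has finitely many variables, so listing them in [s] and numbering them by position
    reduces arbitrary variable types to ordinals. *)
Lemma term_condition_gen alpha beta delta (X Y : Type)
    (t : term Sg (X + Y)) (a b : X -> M) (c d : Y -> M) :
  term_condition alpha beta delta ->
  (forall x, alpha (a x) (b x)) -> (forall y, beta (c y) (d y)) ->
  let ev (u : X -> M) (w : Y -> M) :=
    eval (fun z => match z with inl x => u x | inr y => w y end) t in
  delta (ev a c) (ev a d) -> delta (ev b c) (ev b d).
Proof.
move=> tc ab cd ev; have [m0] := algebra_nonempty M.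
pose s : seq {classic (X + Y)} := vars t.
(* Both blocks use all positions of [s]; where the variable belongs to the other block the value is
   the default [m0], as at the extra last position, which lets [inord] apply. *)
pose l (u : X -> M) (i : 'I_(size s).+1) : M :=
  if onth s i is Some (inl x) then u x else m0.
pose r (w : Y -> M) (i : 'I_(size s).+1) : M :=
  if onth s i is Some (inr y) then w y else m0.
pose f (z : {classic (X + Y)}) : 'I_((size s).+1 + (size s).+1) :=
  match z with
  | inl _ => lshift _ (inord (index z s))
  | inr _ => rshift _ (inord (index z s))
  end.
have evE u w : ev u w = eval (env2 (l u) (r w)) (rename f t).
  rewrite eval_rename; apply: (@eq_in_eval _ _ {classic (X + Y)}) => z zs.
  have zE : onth s (inord (index z s) : 'I_(size s).+1) = Some z.
    rewrite inordK; last by rewrite ltnS index_size.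
    by rewrite onthE (nth_map z) ?nth_index // index_mem.
  by case: z zs zE => z zs zE; rewrite /= /env2 /f
    ?(unsplitK (inl _)) ?(unsplitK (inr _)) /l /r zE.
rewrite !evE; apply: tc => i; rewrite /l /r.
- by case: onth => [[x|y]|]; rewrite ?ab //; apply: (congr_refl (conP alpha)).
- by case: onth => [[x|y]|]; rewrite ?cd //; apply: (congr_refl (conP beta)).
Qed.

(** Modulo [alpha], pass from t(b,c) through t(a,c) and t(a,d) to t(b,d); modulo [beta], replace [c]
    by [d] directly. *)
Lemma term_condition_meet alpha beta :
  term_condition alpha beta (alpha `&` beta).
Proof.
move=> m n t a b c d ab cd /con_meetE[h _]; apply/con_meetE.
have E e : alpha (eval (env2 a e) t) (eval (env2 b e) t).
  apply: congr_eval => i; rewrite /env2; case: split => // j.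
  exact: (congr_refl (conP alpha)).
split; last first.
  apply: congr_eval => i; rewrite /env2; case: split => // j.
  exact: (congr_refl (conP beta)).
apply: (congr_trans (conP alpha) _ (E d)).
exact: (congr_trans (conP alpha) (congr_sym (conP alpha) (E c)) h).
Qed.

Lemma commutator_le_meet alpha beta : commutator alpha beta <= alpha `&` beta.
Proof. exact/commutator_least/term_condition_meet. Qed.

(* [alpha `|` alpha'] lies in the chain closure of the tolerance
   [alpha o alpha' o alpha], and the term condition passes along chains. *)
Lemma term_condition_join alpha alpha' beta delta :
  term_condition alpha beta delta -> term_condition alpha' beta delta ->
  term_condition (alpha `|` alpha') beta delta.
Proof.
move=> tc tc'.
have [ar ar'] := (congr_refl (conP alpha), congr_refl (conP alpha')).
pose r x y := exists uv : M * M, [/\ alpha x uv.1, alpha' uv.1 uv.2 & alpha uv.2 y].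
have rr x : r x x by exists (x, x).
have rP : is_congruence (chain_closure r).
  apply: chain_closure_congruence => //.
  - move=> x y [[u v] /= [xu uv vy]]; exists (v, u).
    by split; [apply: congr_sym vy | apply: congr_sym uv | apply: congr_sym xu];
      apply: conP.
  - move=> o a b /choice[uv uvP].
    exists (oper (fun i => (uv i).1), oper (fun i => (uv i).2)).
    by split; (apply: congr_oper => [|i]; [exact: conP | case: (uvP i)]).
have joinr : alpha `|` alpha' <= MkCon rP.
  rewrite leUx; apply/andP; split; apply/con_leP => x y xy;
    apply: sub_chain_closure => //.
  - by exists (x, x); split => //=.
  - by exists (x, y); split => //=.
move=> m n t a b c d ab cd.
have [i|k [f [<- fb fr] h]] := @chain_closure_family _ r m a b.
  exact: (con_leP _ _ joinr).
suff fh j : delta (eval (env2 (f j) c) t) (eval (env2 (f j) d) t).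
  by rewrite -(fb k).
elim: j => [|j IH] //.
have /choice[uv uvP] := fr j.
apply: (tc m n t (fun i => (uv i).2)) => // [i|]; first by case: (uvP i).
apply: (tc' m n t (fun i => (uv i).1)) => // [i|]; first by case: (uvP i).
by apply: (tc m n t (f j)) => // i; case: (uvP i).
Qed.

End TermCondition.

(** * A congruence as a subalgebra of the square *)

Section SubalgebraOfSquare.
Variables (Sg : signature) (M : algebra Sg) (beta : Con M).

Definition con_carrier : Type := {p : M * M | beta p.1 p.2}.

Definition con_proj (i : bool) (p : con_carrier) : M :=
  if i then (sval p).2 else (sval p).1.

Definition con_pair (x y : M) (xy : beta x y) : con_carrier :=
  exist (fun p : M * M => beta p.1 p.2) (x, y) xy.

Fact con_oper_subproof (o : symbol Sg) (a : 'I_(arity o) -> con_carrier) :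
  beta (oper (con_proj false \o a)) (oper (con_proj true \o a)).
Proof. by apply: (congr_oper (conP beta)) => i; apply: (svalP (a i)). Qed.

Fact con_carrier_inhabited : inhabited con_carrier.
Proof.
have [x] := algebra_nonempty M.
by constructor; apply: (@con_pair x x); apply: congr_refl (conP _) _.
Qed.

Definition con_algebra : algebra Sg :=
  @Algebra Sg con_carrier (fun o a => con_pair (con_oper_subproof a))
    con_carrier_inhabited.

Lemma con_proj_eval (i : bool) (X : Type) (v : X -> con_algebra)
    (t : term Sg X) :
  con_proj i (eval v t) = eval (con_proj i \o v) t.
Proof. by apply: (@eval_hom _ con_algebra M) => o a; case: i. Qed.

Lemma con_algebra_ext (p q : con_algebra) :
  (forall i, con_proj i p = con_proj i q) -> p = q.
Proof.
case: p q => [[x y] xy] [[x' y'] xy'] pq; apply: eq_exist.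
by congr (_, _); [apply: (pq false) | apply: (pq true)].
Qed.

Lemma con_algebra_equational (C : algebra Sg -> Prop) :
  equational_class C -> C M -> C con_algebra.
Proof.
move=> [E CE] /CE ME; apply/CE => e Ee v.
by apply: con_algebra_ext => i; rewrite !con_proj_eval; apply: ME.
Qed.

Fact con_ker_subproof (i : bool) :
  is_congruence (fun p q : con_algebra => con_proj i p = con_proj i q).
Proof.
split=> // [p q r -> //|o a b ab].
have projE (u : 'I_(arity o) -> con_algebra) :
  con_proj i (oper u) = oper (con_proj i \o u) by case: (i).
by rewrite !projE; congr oper; apply/funext.
Qed.

(** This is [eta1] for [i = false] and [eta2] for [i = true]. *)
Definition con_ker (i : bool) : Con con_algebra := MkCon (con_ker_subproof i).

End SubalgebraOfSquare.

(** * The distributive case *)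

Section Distributive.
Variables (Sg : signature) (M : algebra Sg) (alpha beta : Con M).

(** The variables are the related pairs themselves: [i] picks a side of every [alpha]-pair, [j] a
    side of every [beta]-pair. *)
Definition matrix_entry (i j : bool)
    (t : term Sg (con_carrier alpha + con_carrier beta)) : M :=
  eval (fun z => match z with
                 | inl p => con_proj i p
                 | inr p => con_proj j p
                 end) t.

(* [p] and [q] are the rows of a two by two matrix from [M(alpha, beta)]. *)
Definition matrix_rel (p q : con_algebra beta) : Prop :=
  exists t, forall j, con_proj j p = matrix_entry false j t /\
                      con_proj j q = matrix_entry true j t.

Definition con_swap (p : con_carrier alpha) : con_carrier alpha :=
  con_pair (congr_sym (conP alpha) (svalP p)).

Lemma matrix_rel_refl p : matrix_rel p p.
Proof. by exists (Var Sg (inr p)). Qed.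

Lemma matrix_rel_sym p q : matrix_rel p q -> matrix_rel q p.
Proof.
pose f (z : con_carrier alpha + con_carrier beta) :=
  match z with inl p => inl (con_swap p) | inr p => inr p end.
have fE i j t : matrix_entry i j (rename f t) = matrix_entry (~~ i) j t.
  by rewrite /matrix_entry eval_rename; congr eval; apply/funext => -[z|z] //=;
    case: i.
by move=> [t tP]; exists (rename f t) => j; rewrite !fE; have [] := tP j.
Qed.

Lemma matrix_rel_oper (o : symbol Sg) (a b : 'I_(arity o) -> con_algebra beta) :
  (forall i, matrix_rel (a i) (b i)) -> matrix_rel (oper a) (oper b).
Proof.
move=> /choice[ts tsP]; exists (App ts) => j.
have projE (u : 'I_(arity o) -> con_algebra beta) :
  con_proj j (oper u) = oper (con_proj j \o u) by case: (j).
by rewrite !projE; split; congr oper; apply/funext => i;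
  have [] := tsP i j.
Qed.

(** The matrices form a reflexive, symmetric and compatible relation, so its transitive closure is
    already the congruence [Delta]. *)
Definition con_Delta : Con (con_algebra beta) :=
  MkCon (chain_closure_congruence matrix_rel_refl matrix_rel_sym
           matrix_rel_oper).

Lemma con_Delta_diag (x y : M) (xy : alpha x y) (xx : beta x x)
    (yy : beta y y) :
  con_Delta (con_pair xx) (con_pair yy).
Proof.
apply: sub_chain_closure; first exact: matrix_rel_refl.
by exists (Var Sg (inl (con_pair xy))) => -[].
Qed.

(** Each link of the chain is a matrix, and the term condition carries [delta] from one row to the
    other. *)
Lemma con_Delta_term_condition (delta : Con M) (p q : con_algebra beta) :
  term_condition alpha beta delta -> con_Delta p q ->
  delta (con_proj false p) (con_proj true p) ->
  delta (con_proj false q) (con_proj true q).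
Proof.
move=> tc [n [f [<- fq fr]]] h; rewrite -(fq n) //.
elim: {fq}n => // n; have [t tP] := fr n.
have [[-> ->] [-> ->]] := (tP false, tP true).
by apply: (term_condition_gen tc) => u; apply: svalP u.
Qed.

Lemma distributive_meet_le_commutator (C : algebra Sg -> Prop) :
  equational_class C -> congruence_distributive C -> C M ->
  alpha `&` beta <= commutator alpha beta.
Proof.
move=> hC hD hM; apply/con_leP => a b /con_meetE[aab bab].
have br := congr_refl (conP beta).
have Dab : con_Delta (con_pair (br a)) (con_pair bab).
  (* Distributivity splits the left side into a part below [Delta] and the meet of [eta1] and
     [eta2], which is equality. *)
  have /con_leP le : con_ker beta false `&` (con_Delta `|` con_ker beta true)
      <= con_Delta.
    rewrite (hD _ (con_algebra_equational beta hC hM)) leUx leIr /=.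
    apply/con_leP => p q /con_meetE[p1 p2].
    have -> : p = q by apply: con_algebra_ext => -[].
    exact: (congr_refl (conP con_Delta)).
  apply: le; apply/con_meetE; split=> //.
  have /con_leP Dle := leUl con_Delta (con_ker beta true).
  have /con_leP kle := leUr (con_ker beta true) con_Delta.
  (* The path is (a,a), (b,b), (a,b): first [Delta], then [eta2]. *)
  apply: (congr_trans (conP _) (Dle _ _ (con_Delta_diag aab (br a) (br b)))).
  exact: kle.
apply: (con_Delta_term_condition _ Dab).
  exact: commutator_term_condition.
exact: (congr_refl (conP (commutator alpha beta))).
Qed.

End Distributive.

(** * Modular congruence lattices with commutator equal to meet *)

Section Neutral.
Variables (Sg : signature) (A : algebra Sg).
Hypothesis modA : forall x y z : Con A,
  x <= z -> x `|` (y `&` z) = (x `|` y) `&` z.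
Hypothesis commA : forall x y : Con A, commutator x y = x `&` y.
Implicit Types alpha beta phi : Con A.

Lemma neutral_join_meet alpha beta phi :
  alpha `&` beta <= phi -> (phi `|` alpha) `&` (phi `|` beta) = phi.
Proof.
move=> abphi; pose m := (phi `|` alpha) `&` (phi `|` beta).
pose a := alpha `&` (phi `|` beta); pose b := beta `&` (phi `|` alpha).
have phia : phi `|` a = m by rewrite /a modA // leUl.
have phib : phi `|` b = m by rewrite /b modA ?leUl // meetC.
have abphi' : a `&` b <= phi.
  by apply: le_trans abphi; apply: leI2; apply: leIl.
(* Since the meet of [a] and [b] is below [phi], [p] is the join of all pairwise meets of [phi],
   [a], [b]; [x] and [y] are the joins of [a] and [b] with [p]. *)
pose p := (a `&` phi) `|` (b `&` phi).
pose x := a `|` (b `&` phi); pose y := b `|` (a `&` phi).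
have meet_y : phi `&` y = p.
  by rewrite /y meetC joinC -modA ?leIr.
have meet_xy : x `&` y = p.
  have bx : b `&` x = b `&` phi.
    rewrite /x meetC [a `|` _]joinC -modA ?leIl // (join_l _) //.
    by rewrite lexI leIr.
  by rewrite /y meetC [b `|` _]joinC -modA ?bx // /x (le_trans (leIl _ _)) ?leUl.
have tc : term_condition (phi `|` x) y p.
  by apply: term_condition_join; [rewrite -meet_y | rewrite -meet_xy];
    apply: term_condition_meet.
have yle : y <= phi `|` x.
  rewrite leUx (le_trans (leIr phi a)) ?leUl // andbT.
  apply: le_trans (leUr b phi) _; rewrite phib -phia.
  by rewrite leU2 // leUl.
have yp : y <= p.
  by rewrite -(meet_r yle) -commA; apply: commutator_least.
(* It remains that [b <= y <= p <= phi]. *)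
rewrite -/m -phib; apply: join_l.
by rewrite (le_trans _ (le_trans yp _)) ?leUl // leUx !leIr.
Qed.

(** If neither [alpha] nor [beta] were below [phi], both joins with [phi] would lie above the cover
    [m], and so would their meet [phi]. *)
Lemma neutral_prime phi : strictly_meet_irreducible phi -> Spec A phi.
Proof.
move=> [m [phim mle]]; split=> [phiT|alpha beta].
  by have := lt_geF phim; rewrite phiT lex1.
rewrite commA => /neutral_join_meet phiE; apply: contrapT => /not_orP[na nb].
have mU x : ~ x <= phi -> m <= phi `|` x.
  by move=> nx; apply: mle; rewrite lt_neqAle leUl andbT eq_sym eq_joinl; apply/negP.
by have := lt_geF phim; rewrite -phiE lexI !mU.
Qed.

End Neutral.

(** * Primes, meet-irreducibility and finite filters *)

Lemma prime_meet_irreducible (Sg : signature) (A : algebra Sg) (phi : Con A) :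
  Spec A phi -> phi <> \top /\ meet_irreducible phi.
Proof.
move=> [phiT phiP]; split=> // a b phiE.
have le : commutator a b <= phi by rewrite phiE; apply: commutator_le_meet.
by case: (phiP _ _ le) => h; [left | right]; apply/eqP;
  rewrite eq_le h phiE ?leIl ?leIr.
Qed.

Lemma finite_meet_irreducible (disp : Order.disp_t)
    (L : tLatticeType disp) (x : L) :
  finite_set [set y | x <= y] -> x <> \top -> meet_irreducible x ->
  strictly_meet_irreducible x.
Proof.
move=> /finite_seqP[s sE] xT xI; exists (\meet_(y <- s | x < y) y); split.
  (* The empty meet [\top] is strictly above [x], and meet-irreducibility keeps binary meets
     strictly above [x]. *)
  elim/big_ind: _ => // [|a b xa xb].
    by rewrite lt_neqAle lex1 andbT; apply/eqP.
  rewrite lt_neqAle lexI !ltW // !andbT; apply/eqP => /xI[] e.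
  - by move: xa; rewrite -e ltxx.
  - by move: xb; rewrite -e ltxx.
move=> y xy; apply: meets_inf_seq => //.
by have : [set y | x <= y] y by [apply: ltW]; rewrite sE.
Qed.

Theorem corollary3p5 (Sg : signature) (C : algebra Sg -> Prop) (A : algebra Sg)
    (hC : equational_class C) (hA : C A)
    (hcomm : congruence_distributive C \/
       (congruence_modular C /\
        forall alpha beta : Con A, commutator alpha beta = alpha `&` beta))
    (phi : Con A) :
  (strictly_meet_irreducible phi -> Spec A phi) /\
  (Spec A phi -> phi <> \top /\ meet_irreducible phi) /\
  (finite_set [set gamma : Con A | phi <= gamma] ->
     (Spec A phi <-> strictly_meet_irreducible phi) /\
     (strictly_meet_irreducible phi <-> phi <> \top /\ meet_irreducible phi)) /\
  (finite_set [set: Con A] ->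
     (Spec A phi <-> strictly_meet_irreducible phi) /\
     (strictly_meet_irreducible phi <-> phi <> \top /\ meet_irreducible phi)).
Proof.
have [modA commA] : (forall x y z : Con A,
    x <= z -> x `|` (y `&` z) = (x `|` y) `&` z) /\
    (forall x y : Con A, commutator x y = x `&` y).
  case: hcomm => [hD|[hM commA]]; last by split=> // x y z; apply: hM.
  split=> [x y z xz|x y].
    by rewrite [RHS]meetC (hD _ hA) [z `&` x]meetC (meet_l xz) [z `&` y]meetC.
  apply/eqP; rewrite eq_le commutator_le_meet /=.
  exact: (distributive_meet_le_commutator _ _ hC hD hA).
have SI : strictly_meet_irreducible phi -> Spec A phi.
  exact: neutral_prime.
have IS := @prime_meet_irreducible _ A phi.
have fin : finite_set [set gamma : Con A | phi <= gamma] ->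
     (Spec A phi <-> strictly_meet_irreducible phi) /\
     (strictly_meet_irreducible phi <-> phi <> \top /\ meet_irreducible phi).
  move=> /finite_meet_irreducible f.
  by split; [split=> [/IS[]|/SI] | split=> [/SI/IS|[]]].
do 3![split=> //] => finA; apply: fin.
exact: sub_finite_set finA.
Qed.
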